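(* For all positive integers $k$, $$\frac{G^C_k(q;a,c,d)}{(cq;q)_k} = G^P_k(q;a,c,c,d),$$ i.e. $G^C_k(q;a,c,d) = (cq;q)_k\, G^P_k(q;a,b,c,d)\big|_{b=c}$.
   Context: For $n\in\mathbb{N}\cup\{\infty\}$, $(x;q)_n=\prod_{i=0}^{n-1}(1-xq^i)$. A coloured integer is a positive integer $m$ together with a colour, written $m_x$; its value is $m$. Capparelli-type partitions: use colours $a,c,d$ with the total order $1_a<1_c<1_d<2_a<2_c<2_d<3_a<\cdots$. A partition in $\mathcal{C}$ is a finite sequence $\lambda_1\ge\lambda_2\ge\cdots\ge\lambda_s$ of such coloured integers (non-increasing in this order; the empty sequence is allowed) such that whenever $\lambda_i=m_x$ and $\lambda_{i+1}=m'_y$, we have $m-m'\ge C(x,y)$, where $C(a,a)=2,C(a,c)=2,C(a,d)=2$; $C(c,a)=1,C(c,c)=1,C(c,d)=2$; $C(d,a)=0,C(d,c)=1,C(d,d)=2$. $G^C_k(q;a,c,d)=\sum_\lambda q^{|\lambda|}a^{\#_a(\lambda)}c^{\#_c(\lambda)}d^{\#_d(\lambda)}$, summed over $\lambda\in\mathcal{C}$ whose parts all have value at most $k$, where $|\lambda|$ is the sum of the values of the parts and $\#_x(\lambda)$ is the number of parts of colour $x$. Primc-type partitions: use colours $a,b,c,d$ with the total order $1_a<1_b<1_c<1_d<2_a<2_b<2_c<2_d<\cdots$. A partition in $\mathcal{P}$ is a finite non-increasing (in this order) sequence of such coloured integers such that consecutive parts $m_x$ (larger) and $m'_y$ (next)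 satisfy $m-m'\ge P(x,y)$, where $P(a,a)=2,P(a,b)=1,P(a,c)=2,P(a,d)=2$; $P(b,a)=1,P(b,b)=0,P(b,c)=1,P(b,d)=1$; $P(c,a)=0,P(c,b)=1,P(c,c)=0,P(c,d)=2$; $P(d,a)=0,P(d,b)=1,P(d,c)=0,P(d,d)=2$. $G^P_k(q;a,b,c,d)=\sum_\lambda q^{|\lambda|}a^{\#_a}b^{\#_b}c^{\#_c}d^{\#_d}$ over $\lambda\in\mathcal{P}$ whose parts all have value at most $k$. *)

(* Defs.v *)
From HB Require Import structures.
From mathcomp Require Import all_boot all_order all_algebra.
From mathcomp Require Import boolp classical_sets functions cardinality fsbigop.

Set Implicit Arguments.
Unset Strict Implicit.
Unset Printing Implicit Defensive.

Import GRing.Theory.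

Local Open Scope ring_scope.

(* fps R is the ring R[[q]] of formal power series in one variable q;
   [fps_coef f n] is the coefficient of q^n in f. *)
Record fps (R : Type) := FPS { fps_coef : nat -> R }.

Lemma fpsP (R : Type) (f g : fps R) : fps_coef f =1 fps_coef g <-> f = g.
Proof.
split=> [|->//]; case: f g => [f] [g] /= /funext.
by move=> /= ->.
Qed.

HB.instance Definition _ (R : Type) := gen_eqMixin (fps R).
HB.instance Definition _ (R : Type) := gen_choiceMixin (fps R).

Section FpsRing.
Variable R : comNzRingType.
Implicit Types f g h : fps R.

Definition fpsC (c : R) : fps R := FPS (fun n => c *+ (n == 0%N)).
Definition fpsX : fps R := FPS (fun n => (n == 1%N)%:R).
Definition fps_add f g : fps R := FPS (fun n => fps_coef f n + fps_coef g n).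
Definition fps_opp f : fps R := FPS (fun n => - fps_coef f n).
Definition fps_mul f g : fps R :=
  FPS (fun n => \sum_(i < n.+1) fps_coef f i * fps_coef g (n - i)%N).

Fact fps_addA : associative fps_add.
Proof. by move=> f g h; apply/fpsP => n /=; rewrite addrA. Qed.
Fact fps_addC : commutative fps_add.
Proof. by move=> f g; apply/fpsP => n /=; rewrite addrC. Qed.
Fact fps_add0 : left_id (fpsC 0) fps_add.
Proof. by move=> f; apply/fpsP => n /=; rewrite mul0rn add0r. Qed.
Fact fps_addN : left_inverse (fpsC 0) fps_opp fps_add.
Proof. by move=> f; apply/fpsP => n /=; rewrite mul0rn addNr. Qed.

HB.instance Definition _ :=
  GRing.isZmodule.Build (fps R) fps_addA fps_addC fps_add0 fps_addN.

Let trunc n f : {poly R} := \poly_(i < n.+1) fps_coef f i.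

Let truncE n f i : (i <= n)%N -> (trunc n f)`_i = fps_coef f i.
Proof. by move=> le_in; rewrite coef_poly ltnS le_in. Qed.

Let trunc_mul n f g i : (i <= n)%N ->
  fps_coef (fps_mul f g) i = (trunc n f * trunc n g)`_i.
Proof.
move=> le_in; rewrite coefM; apply: eq_bigr => j _.
rewrite !truncE //; first by rewrite (leq_trans (leq_subr _ _)).
by rewrite (leq_trans _ le_in) // -ltnS.
Qed.

Fact fps_mulA : associative fps_mul.
Proof.
move=> f g h; apply/fpsP => n.
transitivity ((trunc n f * (trunc n g * trunc n h))`_n).
  rewrite coefM; apply: eq_bigr => j _.
  by rewrite truncE ?(trunc_mul (n := n)) ?leq_subr // -ltnS.
rewrite mulrA coefM; apply: eq_bigr => j _.
by rewrite truncE ?leq_subr // (trunc_mul (n := n)) // -ltnS.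
Qed.
Fact fps_mulC : commutative fps_mul.
Proof.
by move=> f g; apply/fpsP => n; rewrite !(trunc_mul _ _ (leqnn n)) mulrC.
Qed.
Fact fps_mul1 : left_id (fpsC 1) fps_mul.
Proof.
move=> f; apply/fpsP => n /=; rewrite big_ord_recl /= mul1r subn0.
by rewrite big1 ?addr0 // => i _; rewrite mul0r.
Qed.
Fact fps_mulDl : left_distributive fps_mul fps_add.
Proof.
move=> f g h; apply/fpsP => n /=; rewrite -big_split /=.
by apply: eq_bigr => i _; rewrite mulrDl.
Qed.
Fact fps_1neq0 : fpsC 1 != 0.
Proof.
apply/eqP => /(congr1 (fun f => fps_coef f 0)) /= /eqP.
by rewrite oner_eq0.
Qed.

HB.instance Definition _ := GRing.Zmodule_isComNzRing.Build (fps R)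
  fps_mulA fps_mulC fps_mul1 fps_mulDl fps_1neq0.

(* Units are the series having a multiplicative inverse. *)
Definition fps_unit : pred (fps R) := fun f => `[< exists g, g * f = 1 >].
Definition fps_inv f : fps R :=
  if pselect (exists g, g * f = 1) is left fu then projT1 (cid fu) else f.

Fact fps_mulVr : {in fps_unit, left_inverse 1 fps_inv *%R}.
Proof.
move=> f /asboolP fu; rewrite /fps_inv; case: pselect => // fu'.
by case: cid.
Qed.
Fact fps_unitPl f g : g * f = 1 -> fps_unit f.
Proof. by move=> gf; apply/asboolP; exists g. Qed.
Fact fps_inv_out : {in [predC fps_unit], fps_inv =1 id}.
Proof.
move=> f /asboolP fu; rewrite /fps_inv; by case: pselect.
Qed.

HB.instance Definition _ := GRing.ComNzRing_hasMulInverse.Build (fps R)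
  fps_mulVr fps_unitPl fps_inv_out.

End FpsRing.

Arguments fpsX {R}.

Definition qpoch (A : comNzRingType) (x q : A) (n : nat) : A :=
  \prod_(i < n) (1 - x * q ^+ i).

Lemma fpsCE (R : comNzRingType) (c : R) (f : fps R) n :
  fps_coef (fpsC c * f) n = c * fps_coef f n.
Proof.
rewrite /GRing.mul /= big_ord_recl /= subn0 big1 ?addr0 // => i _.
by rewrite mul0r.
Qed.

Lemma fpsXE (R : comNzRingType) (f : fps R) n :
  fps_coef (fpsX * f) n = if n is m.+1 then fps_coef f m else 0.
Proof.
case: n => [|n]; rewrite {1}/GRing.mul /=; first by rewrite big_ord1 mul0r.
rewrite !big_ord_recl /= mul0r add0r mul1r subn1 big1 ?addr0 // => i _.
by rewrite mul0r.
Qed.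

Lemma fpsXnE (R : comNzRingType) (f : fps R) m n :
  fps_coef (fpsX ^+ m * f) n = if (m <= n)%N then fps_coef f (n - m) else 0.
Proof.
elim: m n => [|m IH] n; first by rewrite expr0 mul1r subn0.
by rewrite exprS -mulrA fpsXE; case: n => [|n] //; rewrite IH subSS.
Qed.

(* Dividing by (cq;q)_k is multiplying by a true inverse: ^-1 does not fall
   back to its default value x^-1 = x on non-units. *)
Lemma qpoch_unit (R : comNzRingType) (c : R) (k : nat) :
  qpoch (fpsC c * fpsX) fpsX k \is a GRing.unit.
Proof.
rewrite /qpoch; elim/big_ind: _ => [||i _]; first exact: unitr1.
  by move=> x y ux uy; rewrite unitrMl.
apply/unitrPr.
exists (FPS (fun n => c ^+ (n %/ i.+1) *+ (i.+1 %| n)%N)).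
rewrite -mulrA -exprS; apply/fpsP => n.
rewrite mulrBl mul1r -mulrA.
transitivity (c ^+ (n %/ i.+1) *+ (i.+1 %| n)%N -
    fps_coef (fpsC c * (fpsX ^+ i.+1 *
      FPS (fun n => c ^+ (n %/ i.+1) *+ (i.+1 %| n)%N))) n); first by [].
rewrite fpsCE fpsXnE; case: ltnP => [le_in|lt_ni].
  rewrite /= dvdn_subl // mulrnAr -exprS.
  have -> : ((n - i.+1) %/ i.+1 = (n %/ i.+1).-1)%N.
    by rewrite -{2}(subnK le_in) divnDr // divnn /= addn1.
  rewrite prednK ?divn_gt0 // subrr.
  by case: n le_in.
rewrite mulr0 subr0 divn_small //= expr0.
by case: n lt_ni => // n lt_ni; rewrite gtnNdvd.
Qed.

(* The coloured integer m_x is the pair (m, x). The colours are ordered by an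
   injective rank, coloured integers lexicographically (value first), and
   partitions are listed from the largest part to the smallest. *)
Section ColouredPartitions.
Variables (T : finType) (rank : T -> nat) (gap : T -> T -> nat).

Definition cint_le (u v : nat * T) : bool :=
  (u.1 < v.1)%N || (u.1 == v.1) && (rank u.2 <= rank v.2)%N.

Definition is_cpart (l : seq (nat * T)) : bool :=
  all (fun u => 0 < u.1)%N l
  && sorted (fun u v => cint_le v u && (v.1 + gap u.2 v.2 <= u.1)%N) l.

Definition cparts_le (k : nat) : set (seq (nat * T)) :=
  [set l | is_cpart l && all (fun u => u.1 <= k)%N l]%classic.

End ColouredPartitions.

Definition cweight (T : finType) (l : seq (nat * T)) : nat :=
  (\sum_(u <- l) u.1)%N.

Definition ccount (T : finType) (x : T) (l : seq (nat * T)) : nat :=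
  count (fun u => u.2 == x) l.

(* The series \sum_(l in A) q^|l| w(l); each coefficient is a finite sum by
   [finite_cparts]. *)
Definition genfun (R : comNzRingType) (T : finType) (A : set (seq (nat * T)))
    (w : seq (nat * T) -> R) : fps R :=
  FPS (fun n => \sum_(l \in [set l | A l /\ cweight l = n]%classic) w l).

Lemma finite_cparts (T : finType) (rank : T -> nat) (gap : T -> T -> nat)
    (k n : nat) :
  finite_set [set l | cparts_le rank gap k l /\ cweight l = n]%classic.
Proof.
pose f (t : n.-bseq ('I_k.+1 * T)) :=
    [seq (nat_of_ord u.1, u.2) | u <- bseqval t].
apply: (@sub_finite_set _ _ (f @` setT)%classic); last first.
  by apply: finite_image; exact: finite_finset.
move=> l [/andP[/andP[l_gt0 _] l_le] wl].
have le_sz : (size [seq (inord u.1 : 'I_k.+1, u.2) | u <- l] <= n)%N.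
  rewrite size_map -wl /cweight; elim: l l_gt0 {l_le wl} => //= u l IH.
  by move=> /andP[u0 /IH l0]; rewrite big_cons -add1n leq_add.
exists (Bseq le_sz) => //; rewrite /f /= -map_comp.
rewrite -[RHS]map_id; apply/eq_in_map => -[m x] /(allP l_le) /= mk.
by rewrite inordK.
Qed.

Inductive capp_colour := Ca | Cc | Cd.
Inductive primc_colour := Pa | Pb | Pc | Pd.

Definition capp_rank (x : capp_colour) : nat :=
  match x with Ca => 0 | Cc => 1 | Cd => 2 end.
Definition primc_rank (x : primc_colour) : nat :=
  match x with Pa => 0 | Pb => 1 | Pc => 2 | Pd => 3 end.

Fact capp_rankK :
  cancel (fun x => inord (capp_rank x) : 'I_3)
         (fun i : 'I_3 => nth Ca [:: Ca; Cc; Cd] i).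
Proof. by case; rewrite /= inordK. Qed.
Fact primc_rankK :
  cancel (fun x => inord (primc_rank x) : 'I_4)
         (fun i : 'I_4 => nth Pa [:: Pa; Pb; Pc; Pd] i).
Proof. by case; rewrite /= inordK. Qed.

HB.instance Definition _ := Finite.copy capp_colour (can_type capp_rankK).
HB.instance Definition _ := Finite.copy primc_colour (can_type primc_rankK).

Definition capp_gap (x y : capp_colour) : nat :=
  match x, y with
  | Ca, Ca => 2 | Ca, Cc => 2 | Ca, Cd => 2
  | Cc, Ca => 1 | Cc, Cc => 1 | Cc, Cd => 2
  | Cd, Ca => 0 | Cd, Cc => 1 | Cd, Cd => 2
  end.

Definition primc_gap (x y : primc_colour) : nat :=
  match x, y with
  | Pa, Pa => 2 | Pa, Pb => 1 | Pa, Pc => 2 | Pa, Pd => 2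
  | Pb, Pa => 1 | Pb, Pb => 0 | Pb, Pc => 1 | Pb, Pd => 1
  | Pc, Pa => 0 | Pc, Pb => 1 | Pc, Pc => 0 | Pc, Pd => 2
  | Pd, Pa => 0 | Pd, Pb => 1 | Pd, Pc => 0 | Pd, Pd => 2
  end.

(* G^C_k(q;a,c,d) and G^P_k(q;a,b,c,d) in R[[q]]. The colour variables are
   arbitrary elements of an arbitrary commutative ring R; taking for R a
   polynomial ring gives the case of indeterminates. *)
Definition GC (R : comNzRingType) (k : nat) (a c d : R) : fps R :=
  genfun (cparts_le capp_rank capp_gap k)
    (fun l => a ^+ ccount Ca l * c ^+ ccount Cc l * d ^+ ccount Cd l).

Definition GP (R : comNzRingType) (k : nat) (a b c d : R) : fps R :=
  genfun (cparts_le primc_rank primc_gap k)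
    (fun l => a ^+ ccount Pa l * b ^+ ccount Pb l
              * c ^+ ccount Pc l * d ^+ ccount Pd l).

(* Main.v *)
(** Let F(m, x) be the generating function of the partitions whose largest part
    is m_x.  Removing that part gives, in both families,
      F(m, x) = x q^m (1 + sum over y and 1 <= i <= m - gap(x, y) of F(i, y)).
    Write G_m for the partitions with parts at most m, D_m for F(m, d) and
    p_m = (cq;q)_m.  For the Capparelli family the equations read
      D_m = d q^m (G_{m-1} + a q^m G_{m-2} - D_{m-1}),
      G_m = (1 + (c + d) q^m) G_{m-1} + (1 + d q^m) a q^m G_{m-2}
            - (c + d) q^m D_{m-1},
    and for the Primc family with b = c the series p_m G_m and p_m D_m satisfy
    the very same recursion, so that they agree with the Capparelli ones. *)
Require Import Defs.
From mathcomp Require Import all_boot all_order all_algebra.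
From mathcomp Require Import boolp classical_sets functions cardinality fsbigop.
From mathcomp Require Import zify ring.

Set Implicit Arguments.
Unset Strict Implicit.
Unset Printing Implicit Defensive.

Import GRing.Theory.
Local Open Scope ring_scope.

(** * Generating functions of sets of coloured sequences *)

(** A sum with infinitely many nonzero terms is 0 by convention, so additivity of [genfun] relies on
    finiteness in each weight. *)
Definition finite_fibers {T : finType} (A : set (seq (nat * T))) :=
  forall n, finite_set [set l | A l /\ cweight l = n]%classic.

Section GeneratingFunctions.
Variables (R : comNzRingType) (T : finType).
Implicit Types (A B : set (seq (nat * T))) (w : seq (nat * T) -> R).

Lemma sub_finite_fibers A B :
  (A `<=` B)%classic -> finite_fibers B -> finite_fibers A.
Proof.
move=> sAB finB n; apply: sub_finite_set (finB n) => l [Al <-].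
by split => //; apply: sAB.
Qed.

Lemma genfun_ext A w w' : w =1 w' -> genfun A w = genfun A w'.
Proof. by move=> /funext ->. Qed.

Lemma genfun0 w : genfun set0 w = 0.
Proof.
apply/fpsP => n; rewrite /= mul0rn.
by rewrite (_ : mkset _ = set0) ?fsbig_set0 // -subset0 => l [].
Qed.

Lemma genfunU A B w : finite_fibers A -> finite_fibers B ->
  (A `&` B = set0)%classic ->
  genfun (A `|` B)%classic w = genfun A w + genfun B w.
Proof.
move=> finA finB AB0; apply/fpsP => n /=; rewrite -fsbigU //=.
- apply: eq_fsbigl; apply/seteqP; split=> l /=.
    by case=> -[] ? ?; [left | right].
  by case=> -[? ?]; split=> //; [left | right].
- by move=> l [[Al _] [Bl _]]; have : (A `&` B)%classic l by []; rewrite AB0.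
Qed.

Lemma genfun_classify (I : eqType) (f : seq (nat * T) -> I) (s : seq I) A w :
  finite_fibers A -> uniq s ->
  genfun [set l | A l /\ f l \in s]%classic w
  = \sum_(i <- s) genfun [set l | A l /\ f l = i]%classic w.
Proof.
move=> finA; elim: s => [_|i s IH /= /andP[i_s /IH {}IH]].
  rewrite big_nil -(genfun0 w); congr genfun.
  by rewrite -subset0 => l [].
rewrite big_cons -IH -genfunU.
- congr genfun; apply/seteqP; split=> l /=.
    by rewrite inE => -[Al /orP[/eqP|]]; [left | right].
  by rewrite inE => -[[Al ->]|[Al ->]]; rewrite ?eqxx ?orbT.
- by apply: sub_finite_fibers finA => l [].
- by apply: sub_finite_fibers finA => l [].
- rewrite -subset0 => l [[_ fl] [_ fls]].
  by rewrite -fl fls in i_s.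
Qed.

Lemma genfun_cons (u : nat * T) (x : R) A w :
  finite_fibers A ->
  (forall l, w (u :: l) = x * w l) ->
  genfun [set u :: l | l in A]%classic w = fpsC x * fpsX ^+ u.1 * genfun A w.
Proof.
move=> finA wE; apply/fpsP => n; rewrite -mulrA fpsCE fpsXnE /=.
have cwE l : cweight (u :: l) = (u.1 + cweight l)%N.
  by rewrite /cweight big_cons.
case: leqP => [le_un | lt_nu]; last first.
  rewrite mulr0 (_ : mkset _ = set0) ?fsbig_set0 // -subset0 => l [[l' _ <-]].
  by rewrite cwE => nE; rewrite -nE ltnNge leq_addr in lt_nu.
rewrite (reindex_fsbig (cons u)
  [set l | A l /\ cweight l = n - u.1]%classic%N).
  rewrite !fsbig_finite // big_distrr /=.
  by apply: eq_bigr => l _; rewrite wE.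
split=> [l [Al wl] | l l' _ _ [] // | l [[l' Al' <-] wl]] /=.
  by split; [exists l | rewrite cwE wl subnKC].
by exists l' => //; split => //; rewrite -wl cwE addKn.
Qed.

End GeneratingFunctions.

(** * Decomposition of partitions by their largest part *)

Section HeadRecursion.
Variables (R : comNzRingType) (T : finType).
Variables (rank : T -> nat) (gap : T -> T -> nat) (v : T -> R).
Local Notation cpart := (is_cpart rank gap).

(* Without this condition the order, and not only the gap, would restrict the
   part that may follow a given one. *)
Hypothesis gap0_rank : forall x y, gap x y = 0%N -> (rank y <= rank x)%N.

(** A product over the parts splits off the head at once, unlike the powers of [ccount], to which it
    is matched later. *)
Definition cmonomial (l : seq (nat * T)) : R := \prod_(u <- l) v u.2.

Definition genfun_max (m : nat) (x : T) : fps R :=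
  genfun [set l | cpart l /\ ohead l = Some (m, x)]%classic cmonomial.

Definition head_le (h : T -> nat) (l : seq (nat * T)) : bool :=
  if l is u :: _ then (u.1 <= h u.2)%N else true.

Lemma finite_fibers_cpart : finite_fibers [set l | cpart l]%classic.
Proof.
move=> n; apply: sub_finite_set (finite_cparts rank gap n n).
move=> l [/= cl wl]; split=> //; rewrite /cparts_le /= cl.
apply/allP => u ul; rewrite -wl /cweight (big_rem u) //=.
exact: leq_addr.
Qed.

(** A positive gap forces a strictly smaller value and a zero gap comes with the right rank order,
    so the gap implies the order and only a bound on the next value remains. *)
Lemma cpart_cons m x l : (0 < m)%N ->
  cpart ((m, x) :: l) = cpart l && head_le (fun y => m - gap x y)%N l.
Proof.
move=> m0; rewrite /is_cpart /= m0 /=.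
case: l => [//|[m' y] l] /=; case: (posnP m') => [->|m'0] //=.
rewrite [X in _ && X]andbC andbA; congr andb.
(* Truncated subtraction is harmless because [m'] is positive. *)
have -> : (m' <= m - gap x y)%N = (m' + gap x y <= m)%N by lia.
rewrite andbC /cint_le /=.
have [le_m|//] := leqP (m' + gap x y) m.
case: (posnP (gap x y)) => [/gap0_rank -> | ?]; last first.
  by rewrite (_ : m' < m)%N //; lia.
by rewrite andbT orbC -leq_eqVlt; lia.
Qed.

Lemma cpart_all_le k l :
  cpart l -> all (fun u => u.1 <= k)%N l = head_le (fun=> k) l.
Proof.
case: l => [//|u l] /andP[_ /= ul] /=.
have [le_uk|//] := leqP u.1 k.
have ge_trans : transitive (fun u v : nat * T => v.1 <= u.1)%N.
  by move=> u1 u2 u3 le12 /leq_trans; apply.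
have /(order_path_min ge_trans) : path (fun u v : nat * T => v.1 <= u.1)%N u l.
  apply: sub_path ul => u1 u2 /andP[_]; exact: leq_trans (leq_addr _ _).
by apply: sub_all => u' /leq_trans; apply.
Qed.

Lemma genfun_head_le (h : T -> nat) :
  genfun [set l | cpart l /\ head_le h l]%classic cmonomial
  = 1 + \sum_y \sum_(i < h y) genfun_max i.+1 y.
Proof.
(* [None] is the head of the empty partition, the source of the term 1; values have the form [i.+1]
   because parts are positive. *)
pose s := None :: [seq Some (i.+1, y) | y <- index_enum T, i <- iota 0 (h y)].
rewrite (_ : mkset _ = [set l | cpart l /\ ohead l \in s]%classic); last first.
  apply/seteqP; split=> -[|[m y] l] //= [cl hl]; split=> //.
    rewrite inE /=; apply/allpairsPdep; exists y, m.-1.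
    rewrite mem_index_enum mem_iota; move: cl => /andP[/= /andP[m0 _] _].
    by rewrite prednK //; split.
  move: hl; rewrite inE /= => /allpairsPdep[y' [i [_]]].
  by rewrite mem_iota => hi [-> ->].
rewrite (@genfun_classify _ _ _ (@ohead _) s); last 2 first.
- exact: finite_fibers_cpart.
- rewrite /= andbC allpairs_uniq_dep /=; first last.
  + by move=> [y i] [y' i'] _ _ /= [-> ->].
  + by move=> y _; exact: iota_uniq.
  + exact: index_enum_uniq.
  by apply/allpairsPdep => -[? [? []]].
rewrite big_cons big_allpairs_dep; congr (_ + _); last first.
  apply: eq_bigr => y _.
  rewrite -(big_mkord xpredT (fun i => genfun_max i.+1 y)).
  by rewrite /index_iota subn0.
apply/fpsP => -[|n] /=.
  rewrite (_ : mkset _ = [set [::]]%classic).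
    by rewrite fsbig_set1 /cmonomial big_nil.
  apply/seteqP; split=> [[|u l] //= [[]] //|l /= ->].
  by rewrite /cweight big_nil.
rewrite (_ : mkset _ = set0) ?fsbig_set0 // -subset0 => -[|u l] //= [[]] //.
by rewrite /cweight big_nil.
Qed.

Lemma genfun_max0 x : genfun_max 0 x = 0.
Proof.
rewrite -(genfun0 cmonomial); congr genfun.
by rewrite -subset0 => -[|[m y] l] [] //= cl [m0 _]; rewrite m0 in cl.
Qed.

Lemma genfun_maxS m x :
  genfun_max m.+1 x = fpsC (v x) * fpsX ^+ m.+1
    * (1 + \sum_y \sum_(i < m.+1 - gap x y) genfun_max i.+1 y).
Proof.
rewrite -genfun_head_le -(genfun_cons (u := (m.+1, x))); last 2 first.
- by apply: sub_finite_fibers finite_fibers_cpart => l [].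
- by move=> l; rewrite /cmonomial big_cons.
congr genfun; apply/seteqP; split=> [[|u l] [cl //= [uE]]|l' [l [cl hl] <-]] /=.
  by move: cl; rewrite uE cpart_cons // => /andP[cl hl]; exists l.
by rewrite cpart_cons // cl.
Qed.

Lemma genfun_cparts_le k :
  genfun (cparts_le rank gap k) cmonomial
  = 1 + \sum_y \sum_(i < k) genfun_max i.+1 y.
Proof.
rewrite -genfun_head_le; congr genfun; apply/seteqP.
split=> l /=; first by case/andP=> cl; rewrite cpart_all_le.
by case=> cl hl; apply/andP; rewrite cpart_all_le.
Qed.

End HeadRecursion.

(** * The recursion common to both families *)

Section Recursion.
Variable A : comNzRingType.
Implicit Types (a c d q : A) (G D : nat -> A).

(* The value G_{-1} = G_0 = 1 needed at m = 0 is [G m.-1]. *)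
Definition capparelli_rec a c d q G D :=
  [/\ G 0%N = 1, D 0%N = 0 & forall m,
    D m.+1 = d * q ^+ m.+1 * (G m + a * q ^+ m.+1 * G m.-1 - D m) /\
    G m.+1 = (1 + (c + d) * q ^+ m.+1) * G m
      + (1 + d * q ^+ m.+1) * (a * q ^+ m.+1) * G m.-1
      - (c + d) * q ^+ m.+1 * D m].

Lemma capparelli_rec_unique a c d q G D G' D' :
  capparelli_rec a c d q G D -> capparelli_rec a c d q G' D' -> G =1 G'.
Proof.
move=> [G0 D0 GD] [G'0 D'0 GD'] m.
(* The recursion reaches back two steps in [G], so the induction carries two consecutive values. *)
suff [] : [/\ G m.-1 = G' m.-1, G m = G' m & D m = D' m] by [].
elim: m => [|m [IHp IHG IHD]]; first by rewrite G0 G'0 D0 D'0.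
by rewrite /= (GD m).1 (GD m).2 (GD' m).1 (GD' m).2 IHp IHG IHD.
Qed.

End Recursion.

(** * Sums over the colours *)

(* Equality on the colours is inherited through [inord] and does not compute. *)
Lemma capp_eqE (x y : capp_colour) : (x == y) = (capp_rank x == capp_rank y).
Proof. by apply/eqP/eqP => [-> //|]; case: x; case: y. Qed.

Lemma primc_eqE (x y : primc_colour) :
  (x == y) = (primc_rank x == primc_rank y).
Proof. by apply/eqP/eqP => [-> //|]; case: x; case: y. Qed.

Lemma sum_capp (V : nmodType) (f : capp_colour -> V) :
  \sum_y f y = f Ca + (f Cc + f Cd).
Proof.
have enumE : perm_eq (index_enum capp_colour) [:: Ca; Cc; Cd].
  apply: uniq_perm => [||x]; first exact: index_enum_uniq.
    by rewrite /= !inE !capp_eqE.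
  by rewrite mem_index_enum !inE !capp_eqE; case: x.
by rewrite (perm_big _ enumE) /= !big_cons big_nil addr0.
Qed.

Lemma sum_primc (V : nmodType) (f : primc_colour -> V) :
  \sum_y f y = f Pa + (f Pb + (f Pc + f Pd)).
Proof.
have enumE : perm_eq (index_enum primc_colour) [:: Pa; Pb; Pc; Pd].
  apply: uniq_perm => [||x]; first exact: index_enum_uniq.
    by rewrite /= !inE !primc_eqE.
  by rewrite mem_index_enum !inE !primc_eqE; case: x.
by rewrite (perm_big _ enumE) /= !big_cons big_nil addr0.
Qed.

(** * The Capparelli family satisfies the recursion *)

Section Capparelli.
Variables (R : comNzRingType) (a c d : R).

Definition capp_var x := match x with Ca => a | Cc => c | Cd => d end.
Local Notation F := (genfun_max capp_rank capp_gap capp_var).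

Lemma GC_sumE k : GC k a c d = 1 + \sum_y \sum_(i < k) F i.+1 y.
Proof.
rewrite -genfun_cparts_le; apply: genfun_ext => l.
elim: l => [|[m x] l IH]; rewrite /cmonomial.
  by rewrite big_nil !expr0 !mulr1.
rewrite big_cons -[\prod_(_ <- l) _]/(cmonomial capp_var l) -IH /ccount.
by rewrite /= !capp_eqE; case: x; rewrite /= ?add0n ?add1n ?exprS; ring.
Qed.

Lemma GC_rec :
  capparelli_rec (fpsC a) (fpsC c) (fpsC d) fpsX
    (fun k => GC k a c d) (fun m => F m Cd).
Proof.
have gapP x y : capp_gap x y = 0%N -> (capp_rank y <= capp_rank x)%N.
  by case: x; case: y.
split=> [||m].
- by rewrite GC_sumE sum_capp !big_ord0 !addr0.
- exact: genfun_max0.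
(* At [m = 0] this holds because no part has value 0. *)
have sumD : \sum_(i < m) F i.+1 Cd = \sum_(i < m.-1) F i.+1 Cd + F m Cd.
  by case: (m) => [|n]; rewrite ?big_ord_recr //= !big_ord0 genfun_max0 addr0.
have FCa : F m.+1 Ca = fpsC a * fpsX ^+ m.+1 * GC m.-1 a c d.
  by rewrite genfun_maxS // sum_capp /= subSS subn1 GC_sumE sum_capp.
(* The gaps 1, 1, 2 allow all that [GC m] counts except a largest part m_d. *)
have FCc : F m.+1 Cc = fpsC c * fpsX ^+ m.+1 * (GC m a c d - F m Cd).
  rewrite genfun_maxS // sum_capp /= !subSS subn1 subn0 GC_sumE sum_capp sumD.
  by ring.
(* The gaps 0, 1, 2 moreover allow a next part of colour a with the same value [m.+1]. *)
have FCd : F m.+1 Cd = fpsC d * fpsX ^+ m.+1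
    * (GC m a c d + fpsC a * fpsX ^+ m.+1 * GC m.-1 a c d - F m Cd).
  rewrite {1}genfun_maxS // sum_capp /= !subSS !subn0 subn1 (big_ord_recr m) /=.
  by rewrite GC_sumE sum_capp sumD FCa; ring.
split=> //.
rewrite GC_sumE sum_capp !big_ord_recr /= FCa FCc FCd (GC_sumE m) sum_capp.
by ring.
Qed.

End Capparelli.

(** * The rescaled Primc family satisfies the recursion *)

Section Primc.
Variables (R : comNzRingType) (a c d : R).

Definition primc_var x :=
  match x with Pa => a | Pb => c | Pc => c | Pd => d end.
Local Notation F := (genfun_max primc_rank primc_gap primc_var).
Local Notation p := (qpoch (fpsC c * fpsX) fpsX).

Lemma GP_sumE k : GP k a c c d = 1 + \sum_y \sum_(i < k) F i.+1 y.
Proof.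
rewrite -genfun_cparts_le; apply: genfun_ext => l.
elim: l => [|[m x] l IH]; rewrite /cmonomial.
  by rewrite big_nil !expr0 !mulr1.
rewrite big_cons -[\prod_(_ <- l) _]/(cmonomial primc_var l) -IH /ccount.
by rewrite /= !primc_eqE; case: x; rewrite /= ?add0n ?add1n ?exprS; ring.
Qed.

Lemma GP_rec :
  capparelli_rec (fpsC a) (fpsC c) (fpsC d) fpsX
    (fun k => p k * GP k a c c d) (fun m => p m * F m Pd).
Proof.
have gapP x y : primc_gap x y = 0%N -> (primc_rank y <= primc_rank x)%N.
  by case: x; case: y.
have pS m : p m.+1 = p m * (1 - fpsC c * fpsX ^+ m.+1).
  by rewrite /qpoch big_ord_recr /= -mulrA -exprS.
have sumP x m : \sum_(i < m) F i.+1 x = \sum_(i < m.-1) F i.+1 x + F m x.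
  by case: m => [|n]; rewrite ?big_ord_recr //= !big_ord0 genfun_max0 // addr0.
have FPa m : F m.+1 Pa
    = fpsC a * fpsX ^+ m.+1 * (GP m.-1 a c c d + F m Pb).
  rewrite genfun_maxS // sum_primc /= !subSS subn1 subn0 GP_sumE sum_primc.
  by rewrite (sumP Pb m); ring.
(* Colour b may repeat, so the series occurs on both sides; [FPb'] solves for it. *)
have FPb m : F m.+1 Pb = fpsC c * fpsX ^+ m.+1 * (GP m a c c d + F m.+1 Pb).
  rewrite {1}genfun_maxS // sum_primc /= !subSS !subn0 GP_sumE sum_primc.
  by rewrite (big_ord_recr m) /=; ring.
have FPb' m : (1 - fpsC c * fpsX ^+ m.+1) * F m.+1 Pb
    = fpsC c * fpsX ^+ m.+1 * GP m a c c d.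
  by rewrite mulrBl mul1r {1}FPb; ring.
(* Colours c and d have the same row of gaps, 0, 1, 0, 2, hence share the factor [H m]. *)
pose H m := GP m a c c d + F m.+1 Pa + F m.+1 Pc - F m Pd.
have FPc m : F m.+1 Pc = fpsC c * fpsX ^+ m.+1 * H m.
  rewrite {1}genfun_maxS // sum_primc /= !subSS !subn0 subn1 /H.
  rewrite GP_sumE sum_primc.
  by rewrite !(big_ord_recr m) /= (sumP Pd m); ring.
have FPd m : F m.+1 Pd = fpsC d * fpsX ^+ m.+1 * H m.
  rewrite {1}genfun_maxS // sum_primc /= !subSS !subn0 subn1 /H.
  rewrite GP_sumE sum_primc.
  by rewrite !(big_ord_recr m) /= (sumP Pd m); ring.
have HE m : (1 - fpsC c * fpsX ^+ m.+1) * H m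
    = GP m a c c d + F m.+1 Pa - F m Pd.
  by rewrite mulrBl mul1r -FPc /H; ring.
(* Here b = c matters: the factor 1 - c q^m of [p m] turns G_{m-1} + F(m, b) into G_{m-1}, since (1
   - c q^m) F(m, b) = c q^m G_{m-1}. *)
have pFPa m : p m * F m.+1 Pa
    = fpsC a * fpsX ^+ m.+1 * (p m.-1 * GP m.-1 a c c d).
  rewrite FPa; case: m => [|m] /=; first by rewrite genfun_max0 //; ring.
  transitivity (fpsC a * fpsX ^+ m.+2 * p m
    * ((1 - fpsC c * fpsX ^+ m.+1) * GP m a c c d
       + (1 - fpsC c * fpsX ^+ m.+1) * F m.+1 Pb)); first by rewrite pS; ring.
  by rewrite FPb'; ring.
have pH m : p m.+1 * H m = p m * GP m a c c d
    + fpsC a * fpsX ^+ m.+1 * (p m.-1 * GP m.-1 a c c d) - p m * F m Pd.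
  by rewrite pS -mulrA HE -pFPa; ring.
split=> [||m].
- by rewrite GP_sumE sum_primc !big_ord0 !addr0 mulr1 /qpoch big_ord0.
- by rewrite genfun_max0 // mulr0.
split; first by rewrite FPd mulrCA pH.
rewrite GP_sumE sum_primc !big_ord_recr /=.
(* The new factor of [p m.+1] is distributed so that each term matches one of the solved forms
   [FPb'], [pFPa], [pH]. *)
transitivity (p m * (1 - fpsC c * fpsX ^+ m.+1) * GP m a c c d
  + (1 - fpsC c * fpsX ^+ m.+1) * (p m * F m.+1 Pa)
  + p m * ((1 - fpsC c * fpsX ^+ m.+1) * F m.+1 Pb)
  + (fpsC c + fpsC d) * fpsX ^+ m.+1 * (p m.+1 * H m)).
  by rewrite FPc FPd pS (GP_sumE m) sum_primc; ring.
by rewrite FPb' pFPa pH; ring.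
Qed.

End Primc.

Theorem theorem1p9 (R : comNzRingType) (a c d : R) (k : nat) (hk : (0 < k)%N) :
  GC k a c d / qpoch (fpsC c * fpsX) fpsX k = GP k a c c d
  /\ GC k a c d = qpoch (fpsC c * fpsX) fpsX k * GP k a c c d.
Proof.
have GCE := capparelli_rec_unique (GC_rec a c d) (GP_rec a c d) k.
split=> //; apply: (mulIr (qpoch_unit c k)).
by rewrite divrK ?qpoch_unit // GCE mulrC.
Qed.
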